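(* Let $X=(X_1,\dots,X_d)$ be a random vector in $\mathbb{S}=[0,\infty)^d$ and let $I\subset\{1,\dots,d\}$ be non-empty. Assume there exists a function $b$, regularly varying at infinity with index $\alpha>0$, such that $\lim_{t\to\infty}b(t)\,\mathbb{P}(X_i>t)=c_i\in(0,\infty)$ for all $i\in I$. Assume that for every $i\in I$ the conditional law of $X/X_i$ given $X_i>t$ converges weakly as $t\to\infty$ to the law of some random vector $\Theta_i=(\Theta_{i,j})_{j=1}^d$ on $\mathbb{S}$. Then, for all Borel measurable $g:\mathbb{S}_{0,I}\to[0,\infty)$ and all $i,j\in I$, $$c_j\,\mathbb{E}\big[g(\Theta_j)\,\mathbf 1\{\Theta_{j,i}>0\}\big]=c_i\,\mathbb{E}\big[g(\Theta_i/\Theta_{i,j})\,\Theta_{i,j}^\alpha\big].$$ In particular, $\mathbb{P}[\Theta_{j,i}>0]=1$ if and only if $\mathbb{E}[\Theta_{i,j}^\alpha]=c_j/c_i$, and then, for all Borel measurable $g:\mathbb{S}_{0,I}\to[0,\infty)$, $$\mathbb{E}[g(\Theta_j)]=\mathbb{E}\big[g(\Theta_i/\Theta_{i,j})\,\Theta_{i,j}^\alpha\big]\big/\mathbb{E}[\Theta_{i,j}^\alpha].$$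
   Context: A positive, measurable function $b$ defined on a neighbourhood of infinity is regularly varying with index $\tau$ if $b(\lambda t)/b(t)\to\lambda^\tau$ as $t\to\infty$ for all $\lambda>0$. $\mathbb{S}_{0,I}=\{x\in\mathbb{S}:\max_{i\in I}x_i>0\}$. Note that $\Theta_{i,i}=1$ almost surely. Convention: the expression $g(\Theta_i/\Theta_{i,j})\,\Theta_{i,j}^\alpha$ is zero on the event $\Theta_{i,j}=0$. *)

(* Defs.v *)
From HB Require Import structures.
From mathcomp Require Import all_boot all_order all_algebra.
From mathcomp Require Import all_classical all_reals all_analysis.
Set Implicit Arguments.
Unset Strict Implicit.
Unset Printing Implicit Defensive.
Import Order.TTheory GRing.Theory Num.Theory.
Import numFieldNormedType.Exports.
Local Open Scope classical_set_scope.
Local Open Scope ring_scope.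

Fact borel_mx_display : measure_display. Proof. exact: default_measure_display. Qed.

(* Borel sigma-algebra of the (product) topology on matrices; row vectors
   'rV[R]_d play the role of points of R^d. *)
Section borel_mx.
Context (R : realType) (m n : nat).
Let G : set (set 'M[R]_(m, n)) := <<s @open 'M[R]_(m, n) >>.

Let borel0 : G set0. Proof. exact: sigma_algebra0. Qed.
Let borelC A : G A -> G (~` A).
Proof. by move=> GA; rewrite -setTD; exact: sigma_algebraCD. Qed.
Let borelU (F : (set 'M[R]_(m, n))^nat) :
  (forall i, G (F i)) -> G (\bigcup_i F i).
Proof. exact: sigma_algebra_bigcup. Qed.

HB.instance Definition _ := @isMeasurable.Build borel_mx_display
  'M[R]_(m, n) G borel0 borelC borelU.
End borel_mx.

Section vectors.
Context (R : realType) (d : nat).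
Implicit Types (x : 'rV[R]_d) (i j : 'I_d) (I : {set 'I_d}).

Definition orthant : set 'rV[R]_d := [set x | forall j, 0 <= x 0 j].

(* The neutral element 0 of the maximum is harmless: coordinates are
   nonnegative on the orthant. *)
Definition orthant0 I : set 'rV[R]_d :=
  orthant `&` [set x | 0 < \big[Num.max/0]_(i in I) x 0 i].

(* x / x_i; the value is 0 when x_i = 0, by the convention 0^-1 = 0. *)
Definition selfnorm i x : 'rV[R]_d := (x 0 i)^-1 *: x.

(* g (x / x_j) * x_j ^ alpha, with the convention that it is 0 if x_j = 0. *)
Definition tilt (alpha : R) (g : 'rV[R]_d -> R) j x : R :=
  if x 0 j == 0 then 0 else g (selfnorm j x) * x 0 j `^ alpha.

(* Extension by 0 of a function that is meaningful only on D. *)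
Definition zext (D : set 'rV[R]_d) (g : 'rV[R]_d -> R) x : R :=
  if x \in D then g x else 0.

Lemma open_measurable_mx (U : set 'rV[R]_d) : open U -> measurable U.
Proof. exact: sub_sigma_algebra. Qed.

Lemma continuous_coord i : continuous (fun x : 'rV[R]_d => x 0 i).
Proof. exact: coord_continuous. Qed.

Lemma measurable_coord_gt i (t : R) : measurable [set x : 'rV[R]_d | t < x 0 i].
Proof.
apply: open_measurable_mx; rewrite (_ : [set _ | _] =
  (fun x : 'rV[R]_d => x 0 i) @^-1` `]t, +oo[%classic); last first.
  by apply/seteqP; split=> x; rewrite /= in_itv/= andbT.
by apply: open_comp => // x _; exact: continuous_coord.
Qed.

Lemma measurable_selfnorm i : measurable_fun setT (selfnorm i).
Proof.
pose N := [set x : 'rV[R]_d | x 0 i != 0].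
have oN : open N.
  rewrite (_ : N = (fun x : 'rV[R]_d => x 0 i) @^-1` (~` [set 0])); last first.
    by apply/seteqP; split=> x /=; [move/eqP | move=> H; apply/eqP].
  apply: open_comp => [x _|]; first exact: continuous_coord.
  by rewrite openC; exact: closed_eq.
apply: (measurability (@open 'rV[R]_d)) => // _ [U oU <-]; rewrite setTI.
have -> : selfnorm i @^-1` U =
    (N `&` selfnorm i @^-1` U) `|` (~` N `&` [set x | U 0]).
  apply/seteqP; split => x /=.
    move=> Ux; case: (eqVneq (x 0 i) 0) => xi; last by left; split.
    by right; split; [rewrite /N/= xi eqxx | move: Ux; rewrite /selfnorm xi invr0 scale0r].
  case=> [[]//|[]]; rewrite /N/=.
  by move/negP; rewrite negbK => /eqP xi U0; rewrite /selfnorm xi invr0 scale0r.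
apply: measurableU.
  apply: open_measurable_mx; rewrite openE => x [Nx Ux]; apply: filterI.
    exact: open_nbhs_nbhs.
  have cx : {for x, continuous (selfnorm i)}.
    apply: (@cvgZ R 'rV[R]_d 'rV[R]_d (nbhs x) _ (fun y => (y 0 i)^-1) id).
      by apply: cvgV => //; exact: continuous_coord.
    exact: cvg_id.
  by apply: cx; exact: open_nbhs_nbhs.
apply: measurableI; first by apply: measurableC; exact: open_measurable_mx.
have [U0|U0] := pselect (U 0).
- by rewrite (_ : [set _ | _] = setT)//; apply/seteqP; split.
- by rewrite (_ : [set _ | _] = set0)//; apply/seteqP; split.
Qed.

HB.instance Definition _ i :=
  isMeasurableFun.Build _ _ _ _ (selfnorm i) (measurable_selfnorm i).

End vectors.

Section probability.
Context (R : realType) (d : nat) (disp : measure_display)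
  (T : measurableType disp).

(* P( . | A); mnormalize falls back to P itself when P A = 0. *)
Definition cond_prob (P : probability T R) (A : set T) (mA : measurable A) :
  probability T R := mnormalize (mrestr P mA) P.

Definition exceed (X : {mfun T >-> 'rV[R]_d}) (i : 'I_d) (t : R) : set T :=
  [set w | t < X w 0 i].

Lemma measurable_exceed (X : {mfun T >-> 'rV[R]_d}) i t :
  measurable (exceed X i t).
Proof.
rewrite -[exceed X i t]setTI.
exact: (measurable_funPT X) measurableT _ (measurable_coord_gt i t).
Qed.

(* The law of X / X_i conditionally on X_i > t. *)
Definition cond_law (P : probability T R) (X : {mfun T >-> 'rV[R]_d})
    (i : 'I_d) (t : R) : probability 'rV[R]_d R :=
  distribution (cond_prob P (measurable_exceed X i t)) (selfnorm i \o X).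

End probability.

(* Weak convergence, as t -> +oo, of probability measures on the subspace D. *)
Definition weak_cvg (R : realType) (d : nat) (D : set 'rV[R]_d)
    (mu : R -> probability 'rV[R]_d R) (nu : probability 'rV[R]_d R) : Prop :=
  forall f : 'rV[R]_d -> R,
    {within D, continuous f} -> (exists M : R, forall x, D x -> `|f x| <= M) ->
    (\int[mu t]_(x in D) (f x)%:E @[t --> +oo%R] --> \int[nu]_(x in D) (f x)%:E)%E.

Definition regularly_varying (R : realType) (b : R -> R) (tau : R) : Prop :=
  (exists M : R, measurable_fun `]M, +oo[ b /\ forall t, M < t -> 0 < b t) /\
  (forall lambda : R, 0 < lambda ->
     b (lambda * t) / b t @[t --> +oo] --> lambda `^ tau).

(* Main.v *)
(** Fix i, j in I and pass to the limit in b(t) E[f(X/X_j); X_j > t] for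
    f(y) = h(y) p(y_i), where p is continuous and supported in a shell
    [u, v] with u > 0.  The integrand is also a function of X/X_i, and on its
    support the event {X_j > t} contains {X_i > v t} and is contained in
    {X_i > u t}.  Since b(t) P(X_i > s t) tends to c_i s^(-alpha), both sides
    of the identity tested against h(y) p(y_i) agree up to a factor
    (v/u)^alpha.  Cutting (0, oo) into thin shells by a continuous partition of
    unity sends this factor to 1, which gives the identity for continuous h.
    Open sets form a pi-system on which both sides are increasing limits of
    such h, so the identity extends to all Borel functions. *)

Require Import Defs.
From HB Require Import structures.
From mathcomp Require Import all_boot all_order all_algebra.
From mathcomp Require Import all_classical all_reals all_analysis.
From mathcomp Require Import measurable_realfun.
From mathcomp Require Import ring lra.
Import Order.TTheory GRing.Theory Num.Theory.
Import numFieldNormedType.Exports.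
Local Open Scope classical_set_scope.
Local Open Scope ring_scope.

(** * Images of weighted measures *)

Section weighted_image.
#[local] Set Implicit Arguments.
#[local] Unset Strict Implicit.
Context d1 d2 (S : measurableType d1) (E : measurableType d2) (R : realType).
Variables (mu : {measure set S -> \bar R}) (V : S -> E) (F : S -> R).
Hypotheses (mV : measurable_fun [set: S] V) (mF : measurable_fun [set: S] F)
  (F0 : forall s, 0 <= F s).

(** The image under [V] of the measure with density [F] with respect to [mu]. The three proofs are
    carried as arguments so that the term itself determines the measure structure attached to it
    below. *)
Definition weighted_image (_ : measurable_fun [set: S] V)
  (_ : measurable_fun [set: S] F) (_ : forall s, 0 <= F s) (A : set E) :=
  (\int[mu]_(s in V @^-1` A) (F s)%:E)%E.

Let nu := weighted_image mV mF F0.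

Let nu0 : nu set0 = 0%E.
Proof. by rewrite /nu /weighted_image preimage_set0 integral_set0. Qed.

Let nu_ge0 A : (0 <= nu A)%E.
Proof. by apply: integral_ge0 => s _; rewrite lee_fin. Qed.

Let nu_sigma_additive : semi_sigma_additive nu.
Proof.
move=> A mA tA mUA; rewrite /nu /weighted_image preimage_bigcup.
have mVA k : measurable (V @^-1` A k) by rewrite -[X in measurable X]setTI; exact: mV.
rewrite ge0_integral_bigcup//=.
- apply: is_cvg_nneseries => k _ _.
  by apply: integral_ge0 => s _; rewrite lee_fin.
- by apply/measurable_EFinP; apply: measurable_funTS.
- by move=> s _; rewrite lee_fin.
- by apply/trivIsetP => i k _ _ ik; rewrite -preimage_setI ((trivIsetP.1 tA) _ _ _ _ ik)// preimage_set0.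
Qed.

HB.instance Definition _ := isMeasure.Build _ _ _ (weighted_image mV mF F0)
  nu0 nu_ge0 nu_sigma_additive.

Import HBNNSimple.

Lemma weighted_image_indic A : measurable A ->
  weighted_image mV mF F0 A = (\int[mu]_s ((\1_A (V s) * F s)%:E))%E.
Proof.
move=> mA; rewrite /weighted_image integral_mkcond.
apply: eq_integral => s _; rewrite restrict_EFin/= patchE indicE.
rewrite (_ : (s \in V @^-1` A) = (V s \in A)); last by apply/idP/idP; rewrite !inE.
by case: (V s \in A); rewrite ?mul1r ?mul0r.
Qed.

(** By monotone convergence both sides are limits along the same increasing simple functions [h n].
    For a simple function, linearity over its finite range reduces the claim to level sets, where it
    is [weighted_image_indic]. *)
Lemma ge0_integral_weighted_image (g : E -> \bar R) :
  measurable_fun [set: E] g -> (forall x, 0 <= g x)%E ->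
  (\int[weighted_image mV mF F0]_x g x = \int[mu]_s (g (V s) * (F s)%:E))%E.
Proof.
move=> mg g0; pose h := nnsfun_approx measurableT mg.
have hg x : (h n x)%:E @[n --> \oo] --> g x by exact: cvg_nnsfun_approx.
have ndh x : {homo (fun n => (h n x)%:E) : m n / (m <= n)%N >-> (m <= n)%E}.
  by move=> m n mn; rewrite lee_fin; exact/lefP/nd_nnsfun_approx.
have mEF : measurable_fun setT (EFin \o F) by exact/measurable_EFinP.
have mh n : measurable_fun setT (EFin \o h n).
  by apply/measurable_EFinP; exact/measurable_funP.
have -> : (\int[weighted_image mV mF F0]_x g x =
    limn (fun n => \int[weighted_image mV mF F0]_x (h n x)%:E))%E.
  rewrite -monotone_convergence//.
    by apply: eq_integral => x _; apply/esym/cvg_lim.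
  by move=> n x _; rewrite lee_fin.
have -> : (\int[mu]_s (g (V s) * (F s)%:E) =
    limn (fun n => \int[mu]_s ((h n (V s))%:E * (F s)%:E)))%E.
  rewrite -monotone_convergence//.
  - by apply: eq_integral => s _; apply/esym/cvg_lim => //; exact: cvgeZr.
  - by move=> n; apply: emeasurable_funM => //; exact: (measurableT_comp (mh n) mV).
  - by move=> n s _; rewrite mule_ge0// lee_fin.
  - by move=> s _ m n mn; rewrite lee_wpmul2r ?lee_fin//; exact/lefP/nd_nnsfun_approx.
congr (limn _); apply/funext => n.
transitivity (\int[weighted_image mV mF F0]_x
    (\sum_(r \in range (h n)) (r * \1_(h n @^-1` [set r]) x)%:E))%E.
  by apply: eq_integral => x _; rewrite fimfunE -fsumEFin.
have mind (r : R) : measurable_fun [set: E] (fun x => r * \1_(h n @^-1` [set r]) x).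
  by exact: measurable_funM.
rewrite ge0_integral_fsum//; last 2 first.
- by move=> r; apply/measurable_EFinP; exact: mind.
- by move=> r x _; exact: nnfun_muleindic_ge0.
transitivity (\int[mu]_s (\sum_(r \in range (h n))
    ((r * \1_(h n @^-1` [set r]) (V s))%:E * (F s)%:E)))%E; last first.
  apply: eq_integral => s _; rewrite -ge0_mule_fsuml; last first.
    by move=> r; exact: nnfun_muleindic_ge0.
  by rewrite fsumEFin// -(fimfunE _ (V s)).
rewrite ge0_integral_fsum//; last 2 first.
- move=> r; apply: emeasurable_funM => //; apply/measurable_EFinP.
  by exact: (measurableT_comp (mind r)).
- by move=> r x _; rewrite mule_ge0 ?lee_fin// -lee_fin nnfun_muleindic_ge0.
apply: eq_fsbigr => r; rewrite inE => -[x _ <-].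
under eq_integral do rewrite EFinM.
rewrite integralZl_indic_nnsfun// integral_indic// setIT/= weighted_image_indic//.
under [RHS]eq_integral do rewrite -EFinM -mulrA EFinM.
rewrite ge0_integralZl_EFin//.
- by move=> s _; rewrite lee_fin mulr_ge0.
- apply/measurable_EFinP; apply: measurable_funM => //.
  by apply: measurableT_comp mV; exact: measurable_indic.
Qed.
End weighted_image.

(** * Continuous test functions determine weighted images *)

Lemma continuous_measurable_mx (R : realType) (d : nat) (f : 'rV[R]_d -> R) :
  continuous f -> measurable_fun [set: 'rV[R]_d] f.
Proof.
move=> /continuousP cf; apply: (measurability _ (RGenOInfty.measurableE R)).
move=> _ [_ [r ->] <-]; rewrite setTI; apply: open_measurable_mx.
by apply: cf; exact: interval_open.
Qed.

(** The approximants are [min (n * D x) 1] with [D] the distance to the complement of [U]: it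
    vanishes off [U] and is positive on [U] because [U] contains a ball around each of its
    points. *)
Lemma indic_open_approx (R : realType) (T : normedModType R) (U : set T) :
  open U -> exists h : nat -> T -> R,
  [/\ forall n, continuous (h n), forall n x, 0 <= h n x <= 1,
      forall x, {homo h ^~ x : m n / (m <= n)%N >-> m <= n} &
      forall x, h n x @[n --> \oo] --> (\1_U x : R)].
Proof.
move=> oU; have [UT|/set0P[a Ua]] := eqVneq (~` U) set0.
  (* The distance to an empty complement would be infinite, so the whole space is treated apart. *)
  exists (fun _ => cst 1); split.
  - by move=> n; exact: cst_continuous.
  - by move=> n x; rewrite /cst/= ler01 lexx.
  - by move=> x m n _; exact: lexx.
  - move=> x; rewrite indicE mem_set; last by rewrite -[U]setCK UT setC0.
    exact: cvg_cst.
pose D x := fine (edist_inf (~` U) x).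
have Dfin x : edist_inf (~` U) x \is a fin_num.
  rewrite ge0_fin_numE ?edist_inf_ge0//; apply: (@le_lt_trans _ _ (edist (x, a))).
    by apply: ereal_inf_lbound; exists a.
  rewrite -ge0_fin_numE ?edist_ge0//; apply/edist_finP => /=; exists (`|x - a| + 1).
    by rewrite ltr_wpDl.
  by rewrite -ball_normE /ball_/= ltrDl.
have D0 x : 0 <= D x by rewrite fine_ge0 ?edist_inf_ge0.
have cD : continuous D.
  move=> x; apply: fine_cvg; rewrite fineK//.
  exact: edist_inf_continuous.
have DU0 x : ~ U x -> D x = 0 by move=> Ux; rewrite /D edist_inf0.
have DU x : U x -> 0 < D x.
  move=> Ux; have /nbhs_ballP[e/= e0 xeU] := open_nbhs_nbhs (conj oU Ux).
  apply: (lt_le_trans e0); rewrite -lee_fin fineK//.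
  apply: le_ereal_inf_tmp => _ [b Ub <-]; rewrite leNgt; apply/negP => xb.
  by apply: Ub; apply: xeU; exact: (edist_lt_ball xb).
exists (fun n x => Num.min (n%:R * D x) 1); split.
- move=> n x; apply: (@continuous_min R T (fun x => n%:R * D x) (cst 1) x).
    by apply: cvgM; [exact: cvg_cst|exact: cD].
  exact: cst_continuous.
- by move=> n x; rewrite le_min ler01 ge_min lexx orbT mulr_ge0.
- move=> x m n mn; rewrite le_min [X in _ && X]ge_min lexx orbT andbT.
  by rewrite ge_min ler_wpM2r ?ler_nat.
- move=> x; rewrite indicE; have [/set_mem Ux|Ux] := boolP (x \in U).
    apply: cvg_near_cst; near=> n; rewrite min_r//.
    rewrite -ler_pdivrMr ?DU//; near: n; exact: nbhs_infty_ger.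
  apply: cvg_near_cst; apply: nearW => n.
  by rewrite DU0 ?mulr0 ?min_l// => Ux'; rewrite mem_set in Ux.
Unshelve. all: by end_near. Qed.

(** Both sides are integrals of [g] against weighted images, so it suffices that these two measures
    agree. They agree on open sets, whose indicators are increasing limits of continuous functions.
    Open sets form a pi-system generating the Borel sets, and the finite total mass gives
    uniqueness. *)
Lemma eq_ge0_integral_weighted (R : realType) (d : nat) d1 d2
    (S1 : measurableType d1) (S2 : measurableType d2)
    (mu1 : {measure set S1 -> \bar R}) (mu2 : {measure set S2 -> \bar R})
    (V1 : S1 -> 'rV[R]_d) (V2 : S2 -> 'rV[R]_d) (F1 : S1 -> R) (F2 : S2 -> R) :
  measurable_fun [set: S1] V1 -> measurable_fun [set: S2] V2 ->
  measurable_fun [set: S1] F1 -> measurable_fun [set: S2] F2 ->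
  (forall s, 0 <= F1 s) -> (forall s, 0 <= F2 s) ->
  (\int[mu1]_s (F1 s)%:E < +oo)%E ->
  (forall h : 'rV[R]_d -> R, continuous h -> (forall x, 0 <= h x <= 1)%R ->
    \int[mu1]_s (h (V1 s) * F1 s)%:E = \int[mu2]_s (h (V2 s) * F2 s)%:E)%E ->
  forall g : 'rV[R]_d -> \bar R,
    measurable_fun [set: 'rV[R]_d] g -> (forall x, 0 <= g x)%E ->
  (\int[mu1]_s (g (V1 s) * (F1 s)%:E) = \int[mu2]_s (g (V2 s) * (F2 s)%:E))%E.
Proof.
move=> mV1 mV2 mF1 mF2 F10 F20 Foo hE g mg g0.
rewrite -(ge0_integral_weighted_image mu1 mV1 mF1 F10)//.
rewrite -(ge0_integral_weighted_image mu2 mV2 mF2 F20)//.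
apply: eq_measure_integral => A mA _.
apply: (measure_unique (@open 'rV[R]_d) (fun=> setT)) => //.
- exact: openI.
- by move=> _; exact: openT.
- by rewrite bigcup_const.
- move=> U oU.
  have [h [ch h01 ndh cvgh]] := @indic_open_approx R _ U oU.
  have mU := open_measurable_mx oU.
  have mh n : measurable_fun setT (h n).
    exact: continuous_measurable_mx.
  have lim d' (S : measurableType d') (mu : {measure set S -> \bar R})
      (V : S -> 'rV[R]_d) (F : S -> R) (mV : measurable_fun setT V)
      (mF : measurable_fun setT F) (F0 : forall s, 0 <= F s) :
      (weighted_image mu mV mF F0 U =
       limn (fun n => \int[mu]_s (h n (V s) * F s)%:E))%E.
    rewrite weighted_image_indic//.
    rewrite -monotone_convergence//.
    + apply: eq_integral => s _; apply/esym/cvg_lim => //.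
      by apply: cvg_EFin; [exact: nearW|apply: cvgMl; exact: cvgh].
    + move=> n; apply/measurable_EFinP; apply: measurable_funM => //.
      exact: measurableT_comp.
    + by move=> n s _; rewrite lee_fin mulr_ge0//; have /andP[] := h01 n (V s).
    + by move=> s _ m n mn; rewrite lee_fin ler_wpM2r// ndh.
  rewrite /= !lim; congr (limn _); apply/funext => n.
  exact: hE.
Qed.

(** * Comparison on thin shells *)

Lemma continuous_powR_gt0 (R : realType) (a x : R) : 0 < x ->
  {for x, continuous (fun y => y `^ a)}.
Proof.
move=> x0; apply: differentiable_continuous; apply/derivable1_diffP.
by apply: derivable_powR; rewrite in_itv/= x0.
Qed.

Lemma measurable_gt0 d (S : measurableType d) (R : realType) (V : S -> R) :
  measurable_fun [set: S] V ->
  measurable_fun [set: S] (fun s => (0 < V s)%R%:R : R).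
Proof.
move=> mV; rewrite (_ : (fun _ => _) = \1_(`]0, +oo[ : set R) \o V); last first.
  apply/funext => s; rewrite /= indicE; congr ((nat_of_bool _)%:R).
  by apply/idP/idP; rewrite inE/= in_itv/= andbT.
exact: measurableT_comp mV.
Qed.

Section shell_comparison.
Context d1 d2 (S1 : measurableType d1) (S2 : measurableType d2) (R : realType).
Variables (mu1 : {measure set S1 -> \bar R}) (mu2 : {measure set S2 -> \bar R}).
Variables (V1 F1 : S1 -> R) (V2 F2 : S2 -> R) (a : R).
Hypotheses (mV1 : measurable_fun [set: S1] V1) (mF1 : measurable_fun [set: S1] F1)
  (mV2 : measurable_fun [set: S2] V2) (mF2 : measurable_fun [set: S2] F2).
Hypotheses (F10 : forall s, 0 <= F1 s) (F20 : forall s, 0 <= F2 s) (a0 : 0 <= a).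
Hypothesis shell : forall (u v : R) (p : R -> R), 0 < u -> u < v ->
  continuous p -> (forall x, 0 <= p x <= 1) -> (forall x, p x != 0 -> u <= x <= v) ->
  (\int[mu1]_s (F1 s * p (V1 s))%:E <=
   ((v / u) `^ a)%:E * \int[mu2]_s (F2 s * p (V2 s))%:E)%E.

Let clamp (x : R) := Num.min (Num.max x 0) 1.

Let clamp_ge0 x : 0 <= clamp x.
Proof. by rewrite le_min ler01 le_max lexx orbT. Qed.

Let clamp_le1 x : clamp x <= 1.
Proof. by rewrite ge_min lexx orbT. Qed.

Let clamp_nd x y : x <= y -> clamp x <= clamp y.
Proof.
move=> xy; rewrite le_min clamp_le1 andbT ge_min; apply/orP; left.
by rewrite ge_max !le_max xy lexx orbT.
Qed.

Let clamp0 x : x <= 0 -> clamp x = 0.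
Proof. by move=> x0; rewrite /clamp (max_idPr x0) min_l. Qed.

Let clamp1 x : 1 <= x -> clamp x = 1.
Proof. by move=> x1; rewrite /clamp max_l ?min_r// (le_trans ler01). Qed.

Let continuous_clamp : continuous clamp.
Proof.
move=> x; apply: (@continuous_min R R (fun y => Num.max y 0) (cst 1) x).
  apply: (@continuous_max R R id (cst 0) x); first exact: cvg_id.
  exact: cst_continuous.
exact: cst_continuous.
Qed.

(* [hat m k] is supported in [k / m^2, (k + 2) / m^2]; for k >= m the endpoints
   of this shell have ratio at most 1 + 2 / m. *)
Let hat (m k : nat) (x : R) :=
  clamp (m%:R ^+ 2 * x - k%:R) - clamp (m%:R ^+ 2 * x - k.+1%:R).

Let continuous_scale_clamp m k : continuous (fun x : R => clamp (m%:R ^+ 2 * x - k%:R)).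
Proof.
move=> x; apply: (@continuous_comp R R R (fun x => m%:R ^+ 2 * x - k%:R)).
  apply: cvgB; last exact: cvg_cst.
  by apply: cvgM; [exact: cvg_cst|exact: cvg_id].
exact: continuous_clamp.
Qed.

Let continuous_hat m k : continuous (hat m k).
Proof. by move=> x; apply: cvgB; exact: continuous_scale_clamp. Qed.

Let hat_itv m k x : 0 <= hat m k x <= 1.
Proof.
rewrite subr_ge0 clamp_nd/=; last by rewrite lerD2l lerN2 ler_nat.
by rewrite lerBlDr (le_trans (clamp_le1 _))// lerDl.
Qed.

Let hat_support m k x : (0 < m)%N -> hat m k x != 0 ->
  k%:R / m%:R ^+ 2 <= x <= k.+2%:R / m%:R ^+ 2.
Proof.
move=> m0; have m20 : 0 < m%:R ^+ 2 :> R by rewrite exprn_gt0// ltr0n.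
apply: contraNT; rewrite negb_and -!ltNge => /orP[xk|kx].
  rewrite ltr_pdivlMr// mulrC in xk.
  by rewrite /hat !clamp0 ?subrr// subr_le0 ltW// (lt_le_trans xk)// ler_nat.
rewrite ltr_pdivrMr// mulrC in kx.
rewrite /hat !clamp1 ?subrr//.
  by rewrite lerBrDr addrC natr1 ltW.
by rewrite lerBrDr addrC natr1 (le_trans _ (ltW kx))// ler_nat.
Qed.

(** The hats telescope to a difference of two clamps. The range of [k] makes the sum vanish below
    1/m and start to decrease only at m, so that the sums exhaust the open half-line. *)
Let bump (m : nat) (x : R) := \sum_(m <= k < m ^ 3) hat m k x.

Let bumpE m x : (0 < m)%N ->
  bump m x = clamp (m%:R ^+ 2 * x - m%:R) - clamp (m%:R ^+ 2 * x - (m ^ 3)%:R).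
Proof.
move=> m0; rewrite /bump /hat.
under eq_bigr do rewrite -opprB.
rewrite sumrN telescope_sumr ?opprB//.
by rewrite -[X in (X <= _)%N]expn1 leq_pexp2l.
Qed.

Let bump_itv m x : 0 <= bump m x <= (0 < x)%R%:R.
Proof.
have [->|m0] := posnP m; first by rewrite /bump big_geq// lexx ler0n.
apply/andP; split; first by apply: sumr_ge0 => k _; have /andP[] := hat_itv m k x.
rewrite bumpE//; have [x0|x0] := ltP 0 x.
  by rewrite lerBlDr (le_trans (clamp_le1 _))// lerDl.
have mx k : m%:R ^+ 2 * x - k%:R <= 0.
  by rewrite subr_le0; apply: le_trans (ler0n _ _); rewrite mulr_ge0_le0.
by rewrite !clamp0 ?subrr.
Qed.

Let bump_cvg x : bump m x @[m --> \oo] --> ((0 < x)%R%:R : R).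
Proof.
have [x0|x0] := ltP 0 x; last first.
  apply: cvg_near_cst; apply: nearW => m; apply/eqP; rewrite eq_le.
  by have := bump_itv m x; rewrite ltNge x0 andbC.
apply: cvg_near_cst; near=> m.
have m0 : (0 < m)%N by near: m; exists 1%N.
(* The bound x <= m keeps the second clamp at 0; the bound 2/x <= m gives m^2 x >= 2m >= m + 1,
   which puts the first clamp at 1. *)
have mx : x <= m%:R by near: m; exact: nbhs_infty_ger.
have m2x : 2 / x <= m%:R by near: m; exact: nbhs_infty_ger.
have m1 : 1 <= m%:R :> R by rewrite ler1n.
rewrite ler_pdivrMr// in m2x.
have ge1 : 1 <= m%:R ^+ 2 * x - m%:R by rewrite expr2; nra.
have le0 : m%:R ^+ 2 * x - (m ^ 3)%:R <= 0.
  by rewrite natrX [_ ^+ 3]exprSr subr_le0 ler_wpM2l// sqr_ge0.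
by rewrite bumpE// clamp1// clamp0// subr0.
Unshelve. all: by end_near. Qed.

(** The hypothesis [shell] is summed over the hats. The ratio of the endpoints is 1 + 2/k <= 1 + 2/m
    for k >= m, so one common factor leaves the sum; on the right the hats add up to at most the
    indicator of [0 < V2]. *)
Let shell_bump m : (0 < m)%N ->
  (\int[mu1]_s (F1 s * bump m (V1 s))%:E <=
   ((1 + 2 / m%:R) `^ a)%:E * \int[mu2]_s (F2 s * (0 < V2 s)%R%:R)%:E)%E.
Proof.
move=> m0.
have mF d (S : measurableType d) (V F : S -> R) k : measurable_fun setT V ->
    measurable_fun setT F ->
    measurable_fun setT (fun s => (F s * hat m k (V s))%:E).
  move=> mV mF; apply/measurable_EFinP; apply: measurable_funM => //.
  by apply: measurableT_comp mV; apply: continuous_measurable_fun; exact: continuous_hat.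
have FhatE d (S : measurableType d) (V F : S -> R) s :
    ((F s * bump m (V s))%:E = \sum_(m <= k < m ^ 3) (F s * hat m k (V s))%:E)%E.
  by rewrite /bump mulr_sumr -sumEFin.
have Fhat0 d (S : measurableType d) (V F : S -> R) k s : (forall s, 0 <= F s) ->
    (0 <= (F s * hat m k (V s))%:E)%E.
  by move=> F0; rewrite lee_fin mulr_ge0//; have /andP[] := hat_itv m k (V s).
under eq_integral do rewrite FhatE.
rewrite ge0_integral_sum//; last 2 first.
- by move=> k; exact: mF.
- by move=> k s _; exact: Fhat0.
apply: (@le_trans _ _ (\sum_(m <= k < m ^ 3)
    ((1 + 2 / m%:R) `^ a)%:E * \int[mu2]_s (F2 s * hat m k (V2 s))%:E)%E).
  rewrite big_nat_cond [leRHS]big_nat_cond.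
  apply: lee_sum => k; rewrite andbT => /andP[mk _].
  have k0 : (0 < k)%N by exact: leq_trans mk.
  have k0R : 0 < k%:R :> R by rewrite ltr0n.
  have m0R : 0 < m%:R :> R by rewrite ltr0n.
  have m20 : 0 < m%:R ^+ 2 :> R by rewrite exprn_gt0.
  apply: le_trans (shell (k%:R / m%:R ^+ 2) (k.+2%:R / m%:R ^+ 2) (hat m k) _ _
    (continuous_hat m k) (hat_itv m k) _) _.
  - by rewrite divr_gt0.
  - by rewrite ltr_pM2r ?invr_gt0// ltr_nat.
  - by move=> x; exact: hat_support.
  rewrite lee_wpmul2r//.
    by apply: integral_ge0 => s _; exact: Fhat0.
  rewrite lee_fin ge0_ler_powR// ?nnegrE.
  - by rewrite ltW// !divr_gt0.
  - by rewrite addr_ge0// divr_ge0.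
  rewrite -mulf_div divff ?mulr1 ?gt_eqF ?invr_gt0//.
  rewrite -addn2 natrD mulrDl divff ?gt_eqF// lerD2l ler_pM2l//.
  by rewrite lef_pV2 ?posrE// ler_nat.
rewrite -ge0_sume_distrr; last first.
  by move=> k _; apply: integral_ge0 => s _; exact: Fhat0.
rewrite lee_wpmul2l// ?lee_fin ?powR_ge0//.
rewrite -ge0_integral_sum//; last 2 first.
- by move=> k; exact: mF.
- by move=> k s _; exact: Fhat0.
rewrite [leLHS](eq_integral (fun s => (F2 s * bump m (V2 s))%:E)); last first.
  by move=> s _; rewrite FhatE.
apply: ge0_le_integral => //.
- move=> s _; rewrite lee_fin mulr_ge0//.
  by have /andP[] := bump_itv m (V2 s).
- under eq_fun do rewrite FhatE.
  by apply: emeasurable_sum => k; exact: mF.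
- apply/measurable_EFinP; apply: measurable_funM => //.
  exact: measurable_gt0.
- move=> s _; rewrite lee_fin ler_wpM2l//.
  by have /andP[] := bump_itv m (V2 s).
Qed.

(** As m grows, [bump m] tends to the indicator of the positive half-line and the factor in
    [shell_bump] tends to 1. Fatou's lemma handles the left side. *)
Lemma shell_comparison :
  (\int[mu1]_s (F1 s * (0 < V1 s)%R%:R)%:E <=
   \int[mu2]_s (F2 s * (0 < V2 s)%R%:R)%:E)%E.
Proof.
have mF1bump m : measurable_fun setT (fun s => (F1 s * bump m (V1 s))%:E).
  apply/measurable_EFinP; apply: measurable_funM => //.
  apply: measurableT_comp mV1; apply: measurable_sum => k.
  by apply: continuous_measurable_fun; exact: continuous_hat.
have F1bump0 m s : (0 <= (F1 s * bump m (V1 s))%:E)%E.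
  by rewrite lee_fin mulr_ge0//; have /andP[] := bump_itv m (V1 s).
rewrite (_ : (\int[mu1]_s _)%E =
    (\int[mu1]_s limn_einf (fun m => (F1 s * bump m (V1 s))%:E))%E); last first.
  apply: eq_integral => s _; apply/esym; apply: (cvg_limn_einf_sup _).1.
  by apply: cvg_EFin; [exact: nearW|apply: cvgMr; exact: bump_cvg].
apply: (le_trans (fatou mu1 measurableT mF1bump _)) => //.
set B := (\int[mu2]_s _)%E.
have B0 : (0 <= B)%E by apply: integral_ge0 => s _; rewrite lee_fin mulr_ge0.
(* An infinite right side is trivial; a finite one allows the factor to pass to the limit. *)
have [Bfin|] := boolP (B \is a fin_num); last first.
  by rewrite ge0_fin_numE// -leNgt leye_eq => /eqP ->; exact: leey.
have cvgB : (((1 + 2 / m%:R) `^ a)%:E * B)%E @[m --> \oo] --> B.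
  rewrite -[X in _ --> X]mul1e; apply: cvgeZr => //.
  apply: cvg_EFin; first exact: nearW.
  have c1S : 1 + 2 / m.+1%:R @[m --> \oo] --> (1 : R).
    rewrite -[X in _ --> X]addr0; apply: cvgD; first exact: cvg_cst.
    by rewrite -[X in _ --> X](mulr0 (2 : R)); apply: cvgMr; exact: cvg_harmonic.
  have c1 : 1 + 2 / m%:R @[m --> \oo] --> (1 : R) by rewrite -cvg_shiftS.
  have := cvg_comp _ _ c1 (@continuous_powR_gt0 R a 1 ltr01).
  by rewrite powR1.
rewrite limn_einf_lim -[leRHS](cvg_lim _ cvgB)//; apply: lee_lim.
- exact: is_cvg_einfs.
- by apply/cvg_ex; exists B.
(* The infimum over the tail from m is at most its first term. *)
near=> m; apply: (@le_trans _ _ (\int[mu1]_s (F1 s * bump m (V1 s))%:E)%E).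
  by apply: ereal_inf_lbound; exists m => //=.
by apply: shell_bump; near: m; exists 1%N.
Unshelve. all: by end_near. Qed.
End shell_comparison.

(** * Limits along exceedances *)

Lemma measurable_orthant (R : realType) (d : nat) : measurable (@orthant R d).
Proof.
rewrite (_ : @orthant R d = ~` \bigcup_(j in [set: 'I_d]) [set x | x 0 j < 0]).
  apply: measurableC; apply: open_measurable_mx; apply: bigcup_open => j _.
  apply: (@open_comp _ _ (fun x : 'rV[R]_d => x 0 j) [set y | y < 0]).
    by move=> x _; exact: continuous_coord.
  exact: open_lt.
apply/seteqP; split=> [x x0 [j _]/=|x /= nx j]; first by rewrite ltNge x0.
by rewrite leNgt; apply/negP => xj; apply: nx; exists j.
Qed.

Section conditional_limit.
Context (R : realType) (d : nat) (disp : measure_display)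
  (T : measurableType disp) (P : probability T R) (X : {mfun T >-> 'rV[R]_d}).
Hypothesis hX : forall w, orthant (X w).
Variable i : 'I_d.

Let measurable_normX : measurable_fun [set: T] (fun w => selfnorm i (X w)).
Proof.
by apply: (measurableT_comp (measurable_selfnorm i)); exact: measurable_funPT.
Qed.

(** The conditional law is the weighted image of [P] with density equal to 1 / P(A) on the
    exceedance event A and 0 elsewhere. Multiplication by P(A) cancels the normalization. *)
Lemma integral_cond_law (t : R) (f : 'rV[R]_d -> R) :
  measurable_fun [set: 'rV[R]_d] f -> (forall x, 0 <= f x) ->
  (0 < P (exceed X i t))%E ->
  (P (exceed X i t) * \int[cond_law P X i t]_(x in @orthant R d) (f x)%:E =
   \int[P]_w (f (selfnorm i (X w)) * \1_(exceed X i t) w)%:E)%E.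
Proof.
move=> mf f0 Pt; set A := exceed X i t.
have mA : measurable A by exact: measurable_exceed.
have PAfin : P A \is a fin_num by exact: fin_num_measure.
pose k := (fine (P A))^-1.
have k0 : 0 <= k by rewrite invr_ge0 fine_ge0.
pose F w := k * \1_A w : R.
have mF : measurable_fun setT F by exact: measurable_funM.
have F0 w : 0 <= F w by rewrite mulr_ge0.
have wiE B : measurable B -> weighted_image P measurable_normX mF F0 B =
    (k%:E * P ((selfnorm i \o X) @^-1` B `&` A))%E.
  move=> mB; rewrite /weighted_image /F.
  have mVB : measurable ((selfnorm i \o X) @^-1` B).
    by rewrite -[X in measurable X]setTI; exact: measurable_normX.
  under eq_integral do rewrite EFinM.
  rewrite ge0_integralZl_EFin//.
  - by rewrite integral_indic// setIC.
  - by apply/measurable_EFinP; exact: measurable_funTS.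
rewrite (@eq_measure_integral _ _ _ _ (weighted_image P measurable_normX mF F0)); last first.
  move=> B mB _; rewrite /= wiE// muleC.
  (* P(A) is positive and finite, so the fallback values of [mnormalize] do not occur. *)
  rewrite /pushforward/= /mnormalize/= /mrestr setTI gt_eqF//= lt_eqF ?ltey_eq ?PAfin//.
rewrite integral_mkcond restrict_EFin ge0_integral_weighted_image; last 2 first.
- by apply/measurable_EFinP; apply/(measurable_restrictT _ (measurable_orthant R d)); exact: measurable_funTS.
- by move=> x; rewrite lee_fin; apply: restrict_ge0 => ? _.
rewrite -ge0_integralZl//; last 2 first.
- apply: emeasurable_funM; last exact/measurable_EFinP.
  apply: (@measurableT_comp _ _ _ _ _ _ (fun x => ((fun y => f y) \_ (@orthant R d) x)%:E)) measurable_normX.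
  by apply/measurable_EFinP/(measurable_restrictT _ (measurable_orthant R d)); exact: measurable_funTS.
- by move=> w _; rewrite mule_ge0// lee_fin// restrict_ge0.
apply: eq_integral => w _; rewrite /= patchE ifT; last first.
  rewrite inE => j; rewrite mxE mulr_ge0// ?invr_ge0; exact: hX.
rewrite -[P A]fineK// -!EFinM /F /k; congr EFin.
rewrite mulrCA; congr (_ * _); rewrite mulrA divff ?mul1r//.
by rewrite gt_eqF// fine_gt0// Pt/= ltey_eq PAfin.
Qed.

(** The expression factors as b(t) / b(st), times b(st) P(X_i > st), times the conditional
    expectation given X_i > st. The factors converge by regular variation, by the tail hypothesis
    and by weak convergence respectively. *)
Lemma cvg_exceed_selfnorm (b : R -> R) (alpha c : R) disp'
    (T' : measurableType disp') (P' : probability T' R)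
    (Theta : {mfun T' >-> 'rV[R]_d}) (f : 'rV[R]_d -> R) (M s : R) :
  regularly_varying b alpha -> 0 < c ->
  ((b t)%:E * P [set w | (t < X w 0 i)%R] @[t --> +oo%R] --> c%:E)%E ->
  (forall w, orthant (Theta w)) ->
  weak_cvg (@orthant R d) (cond_law P X i) (distribution P' Theta) ->
  continuous f -> (forall x, 0 <= f x <= M) -> 0 < s ->
  ((b t)%:E * \int[P]_w (f (selfnorm i (X w)) * \1_(exceed X i (s * t)) w)%:E
     @[t --> +oo%R] --> (c / s `^ alpha)%:E * \int[P']_w (f (Theta w))%:E)%E.
Proof.
move=> [[M0 [_ b_gt0]] hb] c0 hbc hTheta hweak cf f0M s0.
have f0 x : 0 <= f x by have /andP[] := f0M x.
have mf := continuous_measurable_mx _ _ _ cf.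
have cvgst : s * t @[t --> +oo] --> +oo by exact: gt0_cvgMry.
have intTheta : (\int[distribution P' Theta]_(x in @orthant R d) (f x)%:E =
    \int[P']_w (f (Theta w))%:E)%E.
  rewrite ge0_integral_pushforward//.
  - by congr (integral _ _ _); apply/seteqP; split=> // w _; exact: hTheta.
  - exact: measurable_orthant.
  - by apply/measurable_EFinP; exact: measurable_funTS.
  - by move=> x _; rewrite lee_fin.
have cvgf : (\int[cond_law P X i (s * t)]_(x in @orthant R d) (f x)%:E
    @[t --> +oo%R] --> \int[P']_w (f (Theta w))%:E)%E.
  rewrite -intTheta; apply: (cvg_comp _ _ cvgst (hweak f _ _)).
    exact: continuous_subspaceT.
  by exists M => x _; rewrite ger0_norm//; have /andP[] := f0M x.
have bt_gt0 : \forall t \near +oo, 0 < b t.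
  by exists M0; split; [exact: num_real|exact: b_gt0].
have bst_gt0 : \forall t \near +oo, 0 < b (s * t) by exact: (cvgst _ bt_gt0).
have cvgb : b t / b (s * t) @[t --> +oo] --> (s `^ alpha)^-1.
  under eq_fun do rewrite -invf_div.
  by apply: cvgV; [rewrite gt_eqF// powR_gt0|exact: hb].
have cvgbP : ((b (s * t))%:E * P (exceed X i (s * t)) @[t --> +oo%R] --> c%:E)%E.
  exact: (cvg_comp _ _ cvgst hbc).
(* The limit [c] is positive, so the exceedance probability is eventually positive. *)
have P_gt0 : \forall t \near +oo, (0 < P (exceed X i (s * t)))%E.
  near=> t; rewrite lt0e measure_ge0 andbT; apply/negP => /eqP Pt0.
  have : 0 < fine ((b (s * t))%:E * P (exceed X i (s * t)))%E.
    by near: t; apply: (cvgr_gt c) c0; exact: (fine_cvg cvgbP).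
  by rewrite Pt0 mule0 ltxx.
have lim : ((b t / b (s * t))%:E * ((b (s * t))%:E * P (exceed X i (s * t))) *
    \int[cond_law P X i (s * t)]_(x in @orthant R d) (f x)%:E
    @[t --> +oo%R] --> ((s `^ alpha)^-1)%:E * c%:E * \int[P']_w (f (Theta w))%:E)%E.
  (* A nonzero constant keeps the product of the limits from being the indeterminate form 0 times
     infinity. *)
  have sc0 : (s `^ alpha)^-1 * c != 0.
    by rewrite mulf_neq0 ?invr_neq0 ?gt_eqF ?powR_gt0.
  apply: cvgeM => //.
    by rewrite -EFinM /mule_def; case: (integral _ _ _).
  apply: cvgeM => //.
  by apply: cvg_EFin => //; exact: nearW.
rewrite mulrC EFinM; apply: cvg_trans lim; apply: near_eq_cvg; near=> t.
rewrite -integral_cond_law//; last by near: t.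
rewrite !muleA -EFinM divfK// gt_eqF//; by near: t.
Unshelve. all: by end_near. Qed.
End conditional_limit.

(** * Exchange of the normalizing coordinates in test functions *)

Section exchange.
Context (R : realType) (d : nat).
Implicit Types (x : 'rV[R]_d) (i j : 'I_d) (h : 'rV[R]_d -> R) (p : R -> R).

Lemma selfnorm_selfnorm i j x : 0 < x 0 i -> selfnorm j (selfnorm i x) = selfnorm j x.
Proof.
move=> xi; rewrite /selfnorm mxE scalerA invfM invrK mulrAC divff ?scale1r ?mul1r//.
by rewrite gt_eqF.
Qed.

Lemma selfnorm_coordV i j x : (selfnorm i x 0 j)^-1 = selfnorm j x 0 i.
Proof. by rewrite !mxE invfM invrK mulrC. Qed.

(* At z = x / x_i this is the value at y = x / x_j of h y * p (y 0 i). *)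
Definition tilted_test j h p x := h (selfnorm j x) * p (x 0 j)^-1.

(** Only points with x_j = 0 need care. A nonzero value of [p] at 1/y_j forces 0 < u <= 1/y_j <= v,
    hence y_j >= 1/v; so the function vanishes on the neighbourhood y_j < 1/v of such a point. *)
Lemma continuous_tilted_test j h p (u v : R) : 0 < u -> u < v ->
  continuous h -> continuous p -> (forall y, p y != 0 -> u <= y <= v) ->
  continuous (tilted_test j h p).
Proof.
move=> u0 uv ch cp psupp; have v0 := lt_trans u0 uv.
suff: forall x, {for x, continuous (tilted_test j h p)} by [].
move=> x.
have cj : {for x, continuous (fun y : 'rV[R]_d => y 0 j)} by exact: continuous_coord.
have [xj|xj] := eqVneq (x 0 j) 0; last first.
  have cV : {for x, continuous (fun y : 'rV[R]_d => (y 0 j)^-1)} 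
    by exact: (@cvgV R 'rV[R]_d (nbhs x) _ (fun y : 'rV[R]_d => y 0 j) (x 0 j) xj cj).
  have cS : {for x, continuous (selfnorm j)}.
    exact: (@cvgZ R 'rV[R]_d 'rV[R]_d (nbhs x) _ (fun y => (y 0 j)^-1) id _ _ cV cvg_id).
  have chS : {for x, continuous (h \o selfnorm j)}.
    by apply: (@continuous_comp 'rV[R]_d 'rV[R]_d R) => //; exact: ch.
  have cpV : {for x, continuous (p \o (fun y : 'rV[R]_d => (y 0 j)^-1))}.
    by apply: (@continuous_comp 'rV[R]_d R R) => //; exact: cp.
  exact: (cvgM chS cpV).
have zero : \forall y \near x, tilted_test j h p y = 0.
  have near_lt : \forall y \near x, (y : 'rV[R]_d) 0 j < v^-1.
    have xv : x 0 j < v^-1 by rewrite xj invr_gt0.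
    exact: (@cvgr_lt R _ (nbhs x) (nbhs_filter x) _ (x 0 j) cj _ xv).
  apply: (@filterS _ _ (nbhs_filter x) _ _ _ near_lt) => y yv; rewrite /tilted_test.
  have [->|py] := eqVneq (p (y 0 j)^-1) 0; first by rewrite mulr0.
  have /andP[uy yv'] := psupp _ py.
  have y0 : 0 < y 0 j by rewrite -invr_gt0 (lt_le_trans u0).
  by move: yv'; rewrite leNgt -[v]invrK ltf_pV2 ?posrE ?invr_gt0// yv.
rewrite /prop_for /continuous_at (nbhs_singleton zero); apply: cvg_trans (cvg_cst 0).
  apply: near_eq_cvg; first exact: nbhs_filter.
  by apply: (@filterS _ _ (nbhs_filter x) _ _ _ zero) => y ->.
exact: nbhs_filter.
Qed.

(** Where the left side is nonzero, x_i / x_j >= u and x_j > t, hence x_i > u t. Both sides then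
    carry the same test value. *)
Lemma le_test_tilted_test i j h p (u v t : R) x :
  0 < u -> 0 < t -> (forall y, 0 <= h y) -> (forall y, 0 <= p y) ->
  (forall y, p y != 0 -> u <= y <= v) -> orthant x ->
  h (selfnorm j x) * p (selfnorm j x 0 i) * (t < x 0 j)%R%:R <=
  tilted_test j h p (selfnorm i x) * (u * t < x 0 i)%R%:R.
Proof.
move=> u0 t0 h0 p0 psupp x0; rewrite /tilted_test.
have rhs0 : 0 <= h (selfnorm j (selfnorm i x)) * p (selfnorm i x 0 j)^-1 * (u * t < x 0 i)%R%:R.
  by rewrite !mulr_ge0.
have [xj|_] := ltP t (x 0 j); last by rewrite mulr0.
have [pE|py] := eqVneq (p (selfnorm j x 0 i)) 0; first by rewrite pE mulr0 mul0r.
have xj0 := lt_trans t0 xj.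
have /andP[ux xv] := psupp _ py; rewrite mxE mulrC in ux.
rewrite ler_pdivlMr// in ux.
have xi : u * t < x 0 i by rewrite (lt_le_trans _ ux)// ltr_pM2l.
have xi0 : 0 < x 0 i by rewrite (lt_trans _ xi)// mulr_gt0.
by rewrite xi selfnorm_selfnorm// selfnorm_coordV.
Qed.

(** Where the left side is nonzero, x_i / x_j <= v and x_i > v t, hence x_j > t. *)
Lemma le_tilted_test_test i j h p (u v t : R) x :
  0 < u -> u < v -> 0 < t -> (forall y, 0 <= h y) -> (forall y, 0 <= p y) ->
  (forall y, p y != 0 -> u <= y <= v) -> orthant x ->
  tilted_test j h p (selfnorm i x) * (v * t < x 0 i)%R%:R <=
  h (selfnorm j x) * p (selfnorm j x 0 i) * (t < x 0 j)%R%:R.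
Proof.
move=> u0 uv t0 h0 p0 psupp x0; rewrite /tilted_test.
have v0 := lt_trans u0 uv.
have rhs0 : 0 <= h (selfnorm j x) * p (selfnorm j x 0 i) * (t < x 0 j)%R%:R.
  by rewrite !mulr_ge0.
have [xi|_] := ltP (v * t) (x 0 i); last by rewrite mulr0.
have [pE|py] := eqVneq (p (selfnorm i x 0 j)^-1) 0; first by rewrite pE mulr0 mul0r.
have xi0 : 0 < x 0 i by rewrite (lt_trans _ xi)// mulr_gt0.
have := psupp _ py; rewrite selfnorm_coordV mxE mulrC => /andP[ux xv].
have xj0 : 0 < x 0 j.
  by rewrite -invr_gt0 -(pmulr_rgt0 _ xi0) (lt_le_trans u0).
rewrite ler_pdivrMr// in xv.
have xj : t < x 0 j by rewrite -(ltr_pM2l v0) (lt_le_trans xi).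
by rewrite xj selfnorm_selfnorm// selfnorm_coordV.
Qed.
End exchange.

(** * Change of the normalizing coordinate *)

Lemma powRV (R : realType) (x a : R) : 0 <= x -> x^-1 `^ a = (x `^ a)^-1.
Proof. by move=> x0; rewrite -powR_inv1// -powRrM mulN1r powRN. Qed.

Lemma orthant0_gt0 (R : realType) (d : nat) (I : {set 'I_d}) (i : 'I_d)
    (x : 'rV[R]_d) : orthant x -> i \in I -> 0 < x 0 i -> orthant0 I x.
Proof.
by move=> x0 iI xi; split=> //=; apply/bigmax_gtP; right; exists i.
Qed.

Lemma measurable_orthant0 (R : realType) (d : nat) (I : {set 'I_d}) :
  measurable (@orthant0 R d I).
Proof.
rewrite (_ : orthant0 I =
    @orthant R d `&` \bigcup_(i in [set` I]) [set x : 'rV[R]_d | 0 < x 0 i]).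
  apply: measurableI; first exact: measurable_orthant.
  apply: open_measurable_mx; apply: bigcup_open => i _.
  apply: (@open_comp _ _ (fun x : 'rV[R]_d => x 0 i) [set y | 0 < y]).
    by move=> x _; exact: continuous_coord.
  exact: open_gt.
apply/seteqP; split=> [x [x0 /= mx]|x [x0 [i iI xi]]]; last exact: (orthant0_gt0 _ _ _ i).
split=> //; have /bigmax_gtP[|[i iI xi]] := mx; first by rewrite ltxx.
by exists i.
Qed.

Section time_change.
Context (R : realType) (d : nat) (disp : measure_display)
  (T : measurableType disp) (P : probability T R) (X : {mfun T >-> 'rV[R]_d})
  (hX : forall w, orthant (X w)) (b : R -> R) (alpha : R) (alpha0 : 0 < alpha)
  (hb : regularly_varying b alpha) (i j : 'I_d) (ci cj : R) (ci0 : 0 < ci) (cj0 : 0 < cj)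
  (hbi : ((b t)%:E * P [set w | (t < X w 0 i)%R] @[t --> +oo%R] --> ci%:E)%E)
  (hbj : ((b t)%:E * P [set w | (t < X w 0 j)%R] @[t --> +oo%R] --> cj%:E)%E)
  (dispi dispj : measure_display) (Ti : measurableType dispi) (Tj : measurableType dispj)
  (Pi : probability Ti R) (Pj : probability Tj R)
  (Thi : {mfun Ti >-> 'rV[R]_d}) (Thj : {mfun Tj >-> 'rV[R]_d})
  (hThi : forall w, orthant (Thi w)) (hThj : forall w, orthant (Thj w))
  (hweaki : weak_cvg (@orthant R d) (cond_law P X i) (distribution Pi Thi))
  (hweakj : weak_cvg (@orthant R d) (cond_law P X j) (distribution Pj Thj)).

Let measurable_coord d' (S : measurableType d') (V : S -> 'rV[R]_d) k :
  measurable_fun setT V -> measurable_fun setT (fun w => V w 0 k).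
Proof.
move=> mV; apply: (@measurableT_comp _ _ _ _ _ _ (fun x : 'rV[R]_d => x 0 k)) mV.
by apply: continuous_measurable_mx; exact: continuous_coord.
Qed.

Let mThi : measurable_fun setT Thi. Proof. exact: measurable_funPT. Qed.
Let mThj : measurable_fun setT Thj. Proof. exact: measurable_funPT. Qed.

Let mselfThi : measurable_fun setT (selfnorm j \o Thi).
Proof. by apply: measurableT_comp mThi; exact: measurable_selfnorm. Qed.

Let mpowThi : measurable_fun setT (fun w => Thi w 0 j `^ alpha).
Proof.
apply: (@measurableT_comp _ _ _ _ _ _ (@powR R ^~ alpha)).
  exact: measurable_powR.
exact: measurable_coord.
Qed.

(** * The identity for a continuous test function *)

Section test.
Variable h : 'rV[R]_d -> R.
Hypotheses (ch : continuous h) (h01 : forall x, 0 <= h x <= 1).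

Let h0 x : 0 <= h x. Proof. by have /andP[] := h01 x. Qed.
Let mh : measurable_fun setT h. Proof. exact: continuous_measurable_mx. Qed.

(** The data for [shell_comparison]. Both [Vj] and [Vi] represent the ratio of coordinate i to
    coordinate j, the latter as the inverse of the coordinate j of [Thi]. [Vi] is 0 where that
    coordinate is 0. *)
Let Fj w := cj * h (Thj w).
Let Fi w := ci * (h (selfnorm j (Thi w)) * Thi w 0 j `^ alpha).
Let Vj w := Thj w 0 i.
Let Vi w := (Thi w 0 j)^-1.

Let mFj : measurable_fun setT Fj.
Proof. by apply: measurable_funM => //; exact: measurableT_comp mThj. Qed.
Let mFi : measurable_fun setT Fi.
Proof.
by do 2 apply: measurable_funM => //; exact: (measurableT_comp mh mselfThi).
Qed.
Let mVj : measurable_fun setT Vj. Proof. exact: measurable_coord. Qed.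
Let mVi : measurable_fun setT Vi.
Proof.
rewrite (_ : Vi = (fun w => Thi w 0 j `^ (-1))); last first.
  by apply/funext => w; rewrite powR_inv1//; exact: hThi.
apply: (@measurableT_comp _ _ _ _ _ _ (@powR R ^~ (-1))).
  exact: measurable_powR.
exact: measurable_coord.
Qed.
Let Fj0 w : 0 <= Fj w. Proof. by rewrite mulr_ge0// ltW. Qed.
Let Fi0 w : 0 <= Fi w. Proof. by rewrite !mulr_ge0// ?powR_ge0// ltW. Qed.

Section shell.
Variables (u v : R) (p : R -> R).
Hypotheses (u0 : 0 < u) (uv : u < v) (cp : continuous p)
  (p01 : forall x, 0 <= p x <= 1) (psupp : forall x, p x != 0 -> u <= x <= v).

Let p0 x : 0 <= p x. Proof. by have /andP[] := p01 x. Qed.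
Let v0 : 0 < v. Proof. exact: lt_trans uv. Qed.

Let tt := tilted_test R d j h p.
Let ctt : continuous tt. Proof. exact: (continuous_tilted_test _ _ _ _ _ u v). Qed.
Let tt01 x : 0 <= tt x <= 1.
Proof. by rewrite /tt /tilted_test mulr_ge0//= mulr_ile1//; [have /andP[] := h01 (selfnorm j x)|have /andP[] := p01 (x 0 j)^-1]. Qed.
Let mtt : measurable_fun setT tt. Proof. exact: continuous_measurable_mx. Qed.

(** The same test function as [tt], read through X / X_j instead of X / X_i. *)
Let q x := h x * p (x 0 i).
Let cq : continuous q.
Proof.
suff: forall x, {for x, continuous q} by [].
move=> x; have cpx : {for x, continuous (p \o (fun y : 'rV[R]_d => y 0 i))}.
  by apply: (@continuous_comp 'rV[R]_d R R); [exact: continuous_coord|exact: cp].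
exact: (cvgM (ch x) cpx).
Qed.
Let q01 x : 0 <= q x <= 1.
Proof. by rewrite /q mulr_ge0//= mulr_ile1//; [have /andP[] := h01 x|have /andP[] := p01 (x 0 i)]. Qed.

Let cvgi s : 0 < s ->
  ((b t)%:E * \int[P]_w (tt (selfnorm i (X w)) * \1_(exceed X i (s * t)) w)%:E
    @[t --> +oo%R] --> (ci / s `^ alpha)%:E * \int[Pi]_w (tt (Thi w))%:E)%E.
Proof. by move=> s0; apply: cvg_exceed_selfnorm ctt tt01 s0 => //. Qed.

Let cvgj :
  ((b t)%:E * \int[P]_w (q (selfnorm j (X w)) * \1_(exceed X j t) w)%:E
    @[t --> +oo%R] --> \int[Pj]_w (Fj w * p (Vj w))%:E)%E.
Proof.
have := cvg_exceed_selfnorm _ _ _ _ _ _ hX j b alpha cj _ _ _ Thj q 1 1 hb cj0 hbj hThj hweakj cq q01 ltr01.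
rewrite powR1 divr1 -ge0_integralZl_EFin//.
- under eq_fun do rewrite mul1r; under eq_integral do rewrite -EFinM mulrA; exact.
- by move=> w _; rewrite lee_fin; have /andP[] := q01 (Thj w).
- apply/measurable_EFinP; apply: measurableT_comp mThj.
  exact: continuous_measurable_mx.
- exact: ltW.
Qed.

Let bpos : \forall t \near +oo, 0 <= b t.
Proof.
have [[M [_ bM]] _] := hb.
by exists M; split; [exact: num_real|move=> t /bM/ltW].
Qed.

Let mpre k (f : 'rV[R]_d -> R) t : measurable_fun setT f ->
  measurable_fun setT (fun w => (f (selfnorm k (X w)) * \1_(exceed X k t) w)%:E).
Proof.
move=> mf; apply/measurable_EFinP; apply: measurable_funM; last first.
  by apply: measurable_indic; exact: measurable_exceed.
by apply: (measurableT_comp mf); exact: measurableT_comp.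
Qed.

Let exceedE k t w : \1_(exceed X k t) w = (t < X w 0 k)%R%:R :> R.
Proof. by rewrite indicE; congr ((nat_of_bool _)%:R); apply/idP/idP; rewrite inE. Qed.

(** The limit of [le_test_tilted_test], integrated and multiplied by b(t), which is eventually
    nonnegative; [shelli] is obtained from [le_tilted_test_test] in the same way. *)
Let shellj : (\int[Pj]_w (Fj w * p (Vj w))%:E <=
  (ci / u `^ alpha)%:E * \int[Pi]_w (tt (Thi w))%:E)%E.
Proof.
rewrite -(cvg_lim _ cvgj)// -(cvg_lim _ (cvgi u u0))//; apply: lee_lim.
- by apply/cvg_ex; eexists; exact: cvgj.
- by apply/cvg_ex; eexists; exact: (cvgi u).
near=> t; apply: lee_wpmul2l; first by rewrite lee_fin; near: t.
apply: ge0_le_integral => //.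
- by move=> w _; rewrite lee_fin mulr_ge0//; have /andP[] := q01 (selfnorm j (X w)).
- by apply: mpre; exact: continuous_measurable_mx.
- exact: mpre.
- move=> w _; rewrite lee_fin !exceedE; apply: (le_test_tilted_test _ _ _ _ _ _ u v) => //.
Unshelve. all: by end_near. Qed.

Let shelli : ((ci / v `^ alpha)%:E * \int[Pi]_w (tt (Thi w))%:E <=
  \int[Pj]_w (Fj w * p (Vj w))%:E)%E.
Proof.
rewrite -(cvg_lim _ cvgj)// -(cvg_lim _ (cvgi v v0))//; apply: lee_lim.
- by apply/cvg_ex; eexists; exact: (cvgi v).
- by apply/cvg_ex; eexists; exact: cvgj.
near=> t; apply: lee_wpmul2l; first by rewrite lee_fin; near: t.
apply: ge0_le_integral => //.
- by move=> w _; rewrite lee_fin mulr_ge0//; have /andP[] := tt01 (selfnorm i (X w)).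
- exact: mpre.
- by apply: mpre; exact: continuous_measurable_mx.
- move=> w _; rewrite lee_fin !exceedE; apply: (le_tilted_test_test _ _ _ _ _ _ u v) => //.
Unshelve. all: by end_near. Qed.

Let mFip : measurable_fun setT (fun w => (Fi w * p (Vi w))%:E).
Proof.
apply/measurable_EFinP; apply: measurable_funM => //.
by apply: measurableT_comp mVi; exact: continuous_measurable_fun.
Qed.

Let powMul s z : 0 < s -> 0 <= z -> s `^ alpha * z `^ alpha = (s * z) `^ alpha.
Proof. by move=> s0 z0; rewrite powRM// ltW. Qed.

(** The bound [shellj] has the constant weight u^(-alpha) in place of z^alpha, where z is the
    coordinate j of [Thi]. On the support 1/z <= v, so (v z)^alpha >= 1 and u^(-alpha) <=
    (v/u)^alpha z^alpha. *)
Lemma shell_le_ji : (\int[Pj]_w (Fj w * p (Vj w))%:E <=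
  ((v / u) `^ alpha)%:E * \int[Pi]_w (Fi w * p (Vi w))%:E)%E.
Proof.
have shrink w : ci / u `^ alpha * tt (Thi w) <= (v / u) `^ alpha * (Fi w * p (Vi w)).
  rewrite /tt /tilted_test /Fi /Vi; set z := Thi w 0 j; set a := h _.
  have a0 : 0 <= a by exact: h0.
  have z0 : 0 <= z by exact: hThi.
  have [->|pz] := eqVneq (p z^-1) 0; first by rewrite !mulr0.
  have /andP[uz zv] := psupp _ pz.
  have z_gt0 : 0 < z by rewrite -invr_gt0 (lt_le_trans u0).
  have vz : 1 <= v `^ alpha * z `^ alpha.
    have vz1 : 1 <= v * z by rewrite -ler_pdivrMr// div1r.
    rewrite powMul// -[X in X <= _](_ : 1 `^ alpha = 1); last by rewrite powR1.
    by apply: ge0_ler_powR; rewrite ?nnegrE ?mulr_ge0// ltW.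
  rewrite powRM ?invr_ge0 ?(ltW u0) ?(ltW v0)// powRV ?(ltW u0)//.
  set U := (_ `^ _)^-1.
  have -> : v `^ alpha * U * (ci * (a * z `^ alpha) * p z^-1) =
    (v `^ alpha * z `^ alpha) * (ci * U * (a * p z^-1)) by ring.
  by apply: ler_peMl => //; rewrite !mulr_ge0 ?invr_ge0 ?powR_ge0// ltW.
apply: (le_trans shellj); rewrite -!ge0_integralZl_EFin//.
- apply: ge0_le_integral => //.
  + move=> w _; rewrite -EFinM lee_fin mulr_ge0//.
      by rewrite divr_ge0 ?powR_ge0// ltW.
    by have /andP[] := tt01 (Thi w).
  + by apply: measurable_funeM; apply/measurable_EFinP; exact: measurableT_comp mThi.
  + exact: measurable_funeM.
  + by move=> w _; rewrite -!EFinM lee_fin.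
- by move=> w _; rewrite lee_fin mulr_ge0.
- exact: powR_ge0.
- by move=> w _; rewrite lee_fin; have /andP[] := tt01 (Thi w).
- by apply/measurable_EFinP; exact: measurableT_comp mThi.
- by rewrite divr_ge0 ?powR_ge0// ltW.
Qed.

(** On the support 1/z >= u, so z^alpha <= u^(-alpha) = (v/u)^alpha v^(-alpha), and v^(-alpha) is
    the weight in [shelli]. *)
Lemma shell_le_ij : (\int[Pi]_w (Fi w * p (Vi w))%:E <=
  ((v / u) `^ alpha)%:E * \int[Pj]_w (Fj w * p (Vj w))%:E)%E.
Proof.
apply: (@le_trans _ _ (((v / u) `^ alpha)%:E *
    ((ci / v `^ alpha)%:E * \int[Pi]_w (tt (Thi w))%:E))%E); last first.
  by apply: lee_wpmul2l; [rewrite lee_fin powR_ge0|exact: shelli].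
have grow w : Fi w * p (Vi w) <= (v / u) `^ alpha * (ci / v `^ alpha) * tt (Thi w).
  rewrite /tt /tilted_test /Fi /Vi; set z := Thi w 0 j; set a := h _.
  have a0 : 0 <= a by exact: h0.
  have z0 : 0 <= z by exact: hThi.
  have [->|pz] := eqVneq (p z^-1) 0; first by rewrite !mulr0.
  have /andP[uz zv] := psupp _ pz.
  have z_gt0 : 0 < z by rewrite -invr_gt0 (lt_le_trans u0).
  have zu : z `^ alpha <= (u `^ alpha)^-1.
    have zu1 : z <= u^-1 by rewrite -[z]invrK lef_pV2// posrE invr_gt0.
    by rewrite -powRV ?(ltW u0)//; apply: ge0_ler_powR; rewrite ?nnegrE ?invr_ge0// ltW.
  rewrite powRM ?invr_ge0 ?(ltW u0) ?(ltW v0)// powRV ?(ltW u0)//.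
  set U := (u `^ _)^-1 in zu *.
  have -> : v `^ alpha * U * (ci / v `^ alpha) * (a * p z^-1) = U * (ci * (a * p z^-1)).
    by field; rewrite gt_eqF// powR_gt0.
  have -> : ci * (a * z `^ alpha) * p z^-1 = z `^ alpha * (ci * (a * p z^-1)) by ring.
  by rewrite ler_wpM2r// !mulr_ge0// ltW.
rewrite muleA -EFinM -ge0_integralZl_EFin//.
- apply: ge0_le_integral => //.
  + by move=> w _; rewrite lee_fin mulr_ge0.
  + by apply: measurable_funeM; apply/measurable_EFinP; exact: measurableT_comp mThi.
  + by move=> w _; rewrite -!EFinM lee_fin.
- by move=> w _; rewrite lee_fin; have /andP[] := tt01 (Thi w).
- by apply/measurable_EFinP; exact: measurableT_comp mThi.
- by rewrite !mulr_ge0 ?invr_ge0 ?powR_ge0// ltW.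
Qed.
End shell.

(** The two shell bounds carry the same factor, so [shell_comparison] applies in both directions. *)
Lemma eq_test : (\int[Pj]_w (Fj w * (0 < Vj w)%R%:R)%:E =
  \int[Pi]_w (Fi w * (0 < Vi w)%R%:R)%:E)%E.
Proof.
apply/eqP; rewrite eq_le; apply/andP; split.
  apply: (@shell_comparison _ _ _ _ _ _ _ _ _ _ _ alpha) => //; first exact: ltW.
  by move=> u v p *; exact: shell_le_ji.
apply: (@shell_comparison _ _ _ _ _ _ _ _ _ _ _ alpha) => //; first exact: ltW.
by move=> u v p *; exact: shell_le_ij.
Qed.
End test.

Lemma time_change (g : 'rV[R]_d -> \bar R) :
  measurable_fun [set: 'rV[R]_d] g -> (forall x, 0 <= g x)%E ->
  (\int[Pj]_w (g (Thj w) * (cj * (0 < Thj w 0 i)%R%:R)%:E) =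
   \int[Pi]_w (g (selfnorm j (Thi w)) * (ci * Thi w 0 j `^ alpha)%:E))%E.
Proof.
move=> mg g0.
have mpos : measurable_fun setT (fun w => (0 < Thj w 0 i)%R%:R : R).
  by apply: measurable_gt0; exact: measurable_coord.
apply: (eq_ge0_integral_weighted R d _ _ _ _ Pj Pi Thj (selfnorm j \o Thi)
  (fun w => cj * (0 < Thj w 0 i)%R%:R) (fun w => ci * Thi w 0 j `^ alpha)) => //.
- exact: measurable_funM.
- exact: measurable_funM.
- by move=> w; rewrite mulr_ge0// ltW.
- by move=> w; rewrite mulr_ge0 ?powR_ge0// ltW.
(* The weight is at most [cj] under a probability, so the mass is finite. *)
- apply: (@le_lt_trans _ _ (\int[Pj]_w cj%:E)%E).
    apply: ge0_le_integral => //.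
    + by move=> w _; rewrite lee_fin mulr_ge0// ltW.
    + by apply/measurable_EFinP; exact: measurable_funM.
    + move=> w _; rewrite lee_fin ler_piMr//; first exact: ltW.
      by case: (0 < _).
  by rewrite integral_cst//= probability_setT mule1 ltry.
- move=> h ch h01; have := eq_test h ch h01.
  congr (_ = _); apply: eq_integral => w _; congr EFin.
    by rewrite mulrA [h _ * _]mulrC.
  rewrite /= invr_gt0; have [z0|] := ltP 0 (Thi w 0 j); first by rewrite mulr1 mulrCA.
  (* Where the coordinate is 0 the weight vanishes too, as alpha > 0; the indicator of [0 < Vi] can
     thus be dropped. *)
  move=> z0; have -> : Thi w 0 j = 0 by apply/eqP; rewrite eq_le z0; exact: hThi.
  by rewrite powR0 ?gt_eqF// !mulr0.
Qed.
End time_change.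

(** * The identity on the punctured orthant and its almost sure form *)

Theorem corollary3p2 (R : realType) (d : nat)
  (disp : measure_display) (T : measurableType disp) (P : probability T R)
  (X : {mfun T >-> 'rV[R]_d}) (hX : forall w, orthant (X w))
  (I : {set 'I_d}) (hI : (0 < #|I|)%N)
  (b : R -> R) (alpha : R) (halpha : 0 < alpha)
  (hb : regularly_varying b alpha)
  (c : 'I_d -> R) (hc : forall i, i \in I -> 0 < c i)
  (hbc : forall i, i \in I ->
    ((b t)%:E * P [set w | (t < X w 0 i)%R] @[t --> +oo%R] --> (c i)%:E)%E)
  (disp' : 'I_d -> measure_display)
  (T' : forall i, measurableType (disp' i))
  (P' : forall i, probability (T' i) R)
  (Theta : forall i, {mfun T' i >-> 'rV[R]_d})
  (hTheta : forall i, i \in I -> forall w, orthant (Theta i w))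
  (hweak : forall i, i \in I ->
    weak_cvg (@orthant R d) (cond_law P X i) (distribution (P' i) (Theta i))) :
  (forall g : 'rV[R]_d -> R,
    measurable_fun (orthant0 I) g -> (forall x, orthant0 I x -> 0 <= g x) ->
    forall i j, i \in I -> j \in I ->
    ((c j)%:E * 'E_(P' j)[fun w =>
        (g (Theta j w) * \1_[set w' | (0 < Theta j w' 0 i)%R] w)%R]
     = (c i)%:E * 'E_(P' i)[fun w => tilt alpha g j (Theta i w)])%E)
  /\
  (forall i j, i \in I -> j \in I ->
    (P' j [set w | (0 < Theta j w 0 i)%R] = 1%E <->
     ('E_(P' i)[fun w => (Theta i w 0 j `^ alpha)%R] = (c j / c i)%:E)%E)
    /\
    (P' j [set w | (0 < Theta j w 0 i)%R] = 1%E ->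
     forall g : 'rV[R]_d -> R,
     measurable_fun (orthant0 I) g -> (forall x, orthant0 I x -> 0 <= g x) ->
     ('E_(P' j)[fun w => zext (orthant0 I) g (Theta j w)]
      = 'E_(P' i)[fun w => tilt alpha g j (Theta i w)]
        / 'E_(P' i)[fun w => (Theta i w 0 j `^ alpha)%R])%E)).
Proof.
have zextE (g : 'rV[R]_d -> R) x : orthant0 I x -> zext (orthant0 I) g x = g x.
  by move=> Ix; rewrite /zext mem_set.
have mzext (g : 'rV[R]_d -> R) : measurable_fun (orthant0 I) g ->
    measurable_fun setT (zext (orthant0 I) g).
  by move=> mg; exact/(measurable_restrictT g (measurable_orthant0 R d I)).
have zext0 (g : 'rV[R]_d -> R) : (forall x, orthant0 I x -> 0 <= g x) ->
    forall x, 0 <= zext (orthant0 I) g x.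
  by move=> g0 x; rewrite /zext; case: ifPn => // /set_mem /g0.
have mcoord k l : measurable_fun setT (fun w => Theta k w 0 l).
  apply: (@measurableT_comp _ _ _ _ _ _ (fun x : 'rV[R]_d => x 0 l)).
    by apply: continuous_measurable_mx; exact: continuous_coord.
  exact: measurable_funPT.
have key (g : 'rV[R]_d -> R) i j : measurable_fun (orthant0 I) g ->
    (forall x, orthant0 I x -> 0 <= g x) -> i \in I -> j \in I ->
    ((c j)%:E * \int[P' j]_w (g (Theta j w) * \1_[set w' | (0 < Theta j w' 0 i)%R] w)%:E
     = (c i)%:E * \int[P' i]_w (tilt alpha g j (Theta i w))%:E)%E.
  move=> mg g0 iI jI.
  have mEzext : measurable_fun setT (EFin \o zext (orthant0 I) g).
    by apply/measurable_EFinP; exact: mzext.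
  (* A positive coordinate i with i in [I] places the vector in [orthant0 I], so extending [g] by 0
     is harmless. *)
  have gind w : (g (Theta j w) * \1_[set w' | (0 < Theta j w' 0 i)%R] w)%:E =
      (zext (orthant0 I) g (Theta j w) * (0 < Theta j w 0 i)%R%:R)%:E.
    rewrite indicE; congr EFin; have [thi|thi] := boolP (0 < Theta j w 0 i).
      by rewrite mem_set// zextE//; apply: orthant0_gt0 thi => //; exact: hTheta.
    by rewrite memNset ?mulr0//; exact/negP.
  have gtilt w : (tilt alpha g j (Theta i w))%:E =
      (zext (orthant0 I) g (selfnorm j (Theta i w)) * Theta i w 0 j `^ alpha)%:E.
    (* At 0 both sides vanish, as 0^alpha = 0. Otherwise the normalized vector has coordinate j
       equal to 1 and lies in [orthant0 I]. *)
    rewrite /tilt; case: eqP => [->|/eqP z0]; first by rewrite powR0 ?mulr0// gt_eqF.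
    rewrite zextE//; apply: (@orthant0_gt0 _ _ _ j) => //.
      by move=> k; rewrite mxE mulr_ge0 ?invr_ge0//; exact: hTheta.
    by rewrite mxE mulVf.
  have := time_change R d disp T P X hX b alpha halpha hb i j (c i) (c j)
    (hc i iI) (hc j jI) (hbc i iI) (hbc j jI) _ _ _ _ (P' i) (P' j) (Theta i) (Theta j)
    (hTheta i iI) (hTheta j jI) (hweak i iI) (hweak j jI) _ mEzext
    (fun x => zext0 g g0 x).
  rewrite [X in (X = _)%E](_ : _ = (c j)%:E * \int[P' j]_w
      (g (Theta j w) * \1_[set w' | (0 < Theta j w' 0 i)%R] w)%:E)%E; last first.
    rewrite -ge0_integralZl_EFin//; last 3 first.
    - by move=> w _; rewrite gind lee_fin mulr_ge0// zext0.
    - under eq_fun do rewrite gind; apply/measurable_EFinP; apply: measurable_funM.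
        by apply: (@measurableT_comp _ _ _ _ _ _ (zext (orthant0 I) g)) => //; exact: mzext.
      by apply: measurable_gt0; exact: mcoord.
    - exact/ltW/hc.
    by apply: eq_integral => w _; rewrite gind -!EFinM mulrCA.
  rewrite [X in (_ = X)%E -> _](_ : _ = (c i)%:E * \int[P' i]_w (tilt alpha g j (Theta i w))%:E)%E//.
  rewrite -ge0_integralZl_EFin//; last 3 first.
  - by move=> w _; rewrite gtilt lee_fin mulr_ge0 ?powR_ge0// zext0.
  - under eq_fun do rewrite gtilt; apply/measurable_EFinP; apply: measurable_funM.
      apply: (@measurableT_comp _ _ _ _ _ _ (zext (orthant0 I) g)).
        exact: mzext.
      apply: (@measurableT_comp _ _ _ _ _ _ (selfnorm j)).
        exact: measurable_selfnorm.
      exact: measurable_funPT.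
    apply: (@measurableT_comp _ _ _ _ _ _ (@powR R ^~ alpha)).
      exact: measurable_powR.
    exact: mcoord.
  - exact/ltW/hc.
  by apply: eq_integral => w _; rewrite gtilt -!EFinM mulrCA.
split; first by move=> g mg g0 i j iI jI; rewrite unlock; exact: key.
move=> i j iI jI.
have mA : measurable [set w | (0 < Theta j w 0 i)%R].
  rewrite -[X in measurable X]setTI.
  exact: (measurable_funPT (Theta j) measurableT _ (measurable_coord_gt i 0)).
have tilt1 w : tilt alpha (cst 1) j (Theta i w) = Theta i w 0 j `^ alpha.
  rewrite /tilt; case: eqP => [->|_]; last by rewrite mul1r.
  by rewrite powR0// gt_eqF.
(* The choice g = 1 relates the probability to the moment, from which the equivalence follows. *)
have PE : ((c j)%:E * P' j [set w | (0 < Theta j w 0 i)%R] =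
    (c i)%:E * \int[P' i]_w (Theta i w 0 j `^ alpha)%:E)%E.
  have := key (cst 1) i j (measurable_cst _) (fun _ _ => ler01) iI jI.
  under [X in (_ = _ * X)%E -> _]eq_integral do rewrite tilt1.
  move=> <-; congr (_ * _)%E; under eq_integral do rewrite mul1r.
  by rewrite integral_indic// setIT.
have ci0 := hc i iI; have cj0 := hc j jI.
have EE : (\int[P' i]_w (Theta i w 0 j `^ alpha)%:E =
    (c j / c i)%:E * P' j [set w | (0 < Theta j w 0 i)%R])%E.
  rewrite mulrC EFinM -muleA PE muleA -EFinM mulVf ?mul1e// gt_eqF//.
have posE : P' j [set w | (0 < Theta j w 0 i)%R] = 1%E <->
    (\int[P' i]_w (Theta i w 0 j `^ alpha)%:E = (c j / c i)%:E)%E.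
  rewrite EE; split=> [->|]; first by rewrite mule1.
  move=> PE1; rewrite -[LHS]mul1e -[1%E](_ : (c i / c j)%:E * (c j / c i)%:E = 1)%E.
    by rewrite -muleA PE1 -EFinM mulrA divfK ?divff ?gt_eqF.
  by rewrite -EFinM mulrA divfK ?divff ?gt_eqF.
split; first by rewrite unlock.
move=> P1 g mg g0; rewrite unlock (posE.1 P1) inver gt_eqF ?divr_gt0// invf_div.
(* Under [P1] the event of a positive coordinate i has full probability, so both integrands agree
   off its null complement. *)
have A_ae (f := fun w => zext (orthant0 I) g (Theta j w)) :
    (\int[P' j]_w (f w)%:E =
     \int[P' j]_w (g (Theta j w) * \1_[set w' | (0 < Theta j w' 0 i)%R] w)%:E)%E.
  have fgE w : (0 < Theta j w 0 i)%R ->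
      g (Theta j w) * \1_[set w' | (0 < Theta j w' 0 i)%R] w = f w.
    move=> thi; rewrite /f indicE mem_set// mulr1 zextE//.
    by apply: orthant0_gt0 thi => //; exact: hTheta.
  have f0 w : 0 <= f w by exact: zext0.
  have fgE' w : g (Theta j w) * \1_[set w' | (0 < Theta j w' 0 i)%R] w =
      f w * (0 < Theta j w 0 i)%R%:R.
    have [thi|thi] := boolP (0 < Theta j w 0 i); first by rewrite fgE// mulr1.
    by rewrite indicE memNset ?mulr0//; exact/negP.
  have mf : measurable_fun setT f.
    by apply: (@measurableT_comp _ _ _ _ _ _ (zext (orthant0 I) g)) => //; exact: mzext.
  apply: ge0_ae_eq_integral => //.
  - by apply/measurable_EFinP.
  - under eq_fun do rewrite fgE'; apply/measurable_EFinP; apply: measurable_funM => //.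
    by apply: measurable_gt0; exact: mcoord.
  - by move=> w _; rewrite lee_fin.
  - by move=> w _; rewrite fgE' lee_fin mulr_ge0.
  - exists (~` [set w | (0 < Theta j w 0 i)%R]); split.
    + exact: measurableC.
    + by apply: (etrans (probability_setC _ mA)); rewrite P1 subee.
    + move=> w /= nfg thi; apply: nfg => _; congr EFin; exact/esym/fgE.
(* The factor [c j] is inserted so that [key] applies; the remaining c_i / c_j is the inverse of the
   moment. *)
rewrite A_ae -[LHS]mul1e -[1%E](_ : (c j)^-1%:E * (c j)%:E = 1)%E; last first.
  by rewrite -EFinM mulVf// gt_eqF.
by rewrite -muleA key// muleA -EFinM muleC mulrC.
Qed.
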